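(* Let $r\ge 2$. Let $U_{n,\ell}^{(r)}$ be the total number of $\mathbf{u}$-steps at level $\ell+1$ over all paths in $\mathcal{A}_{n+1,0}^{(r)}$. Then for all integers $n\ge\ell\ge 0$, $$U_{n,\ell}^{(r)}=\sum_{j=0}^{n-\ell}\binom{n-\ell}{j}\left\{\frac{2\ell+2}{2n-j+2}\binom{2n-j+2}{n-\ell}+\frac{(2\ell+3)(r-1)}{2n-j+3}\binom{2n-j+3}{n-\ell}\right\}(r-1)^{n-j},$$ with $U_{0,0}^{(r)}=r$. Moreover, $U_{n,\ell}^{(r)}$ is the $(n,\ell)$-entry of the Riordan array $\left(S_r(x)^2(1+(r-1)S_r(x)),\ x(r-1)S_r(x)^2\right)$, i.e. $U_{n,\ell}^{(r)}=[x^n]S_r(x)^2(1+(r-1)S_r(x))\left(x(r-1)S_r(x)^2\right)^{\ell}$.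
   Context: A Dyck path of length $2n$ is a lattice path from $(0,0)$ to $(2n,0)$ weakly above the $x$-axis with steps $\mathbf{u}=(1,1)$, $\mathbf{d}=(1,-1)$; an $r$-colored Dyck path has each $\mathbf{d}$-step colored with one of $r$ colors. $\mathcal{A}_{n,0}^{(r)}$ is the set of $r$-colored Dyck paths of length $2n$ with no two consecutive $\mathbf{d}$-steps of the same color. A step is at level $\ell$ if the ordinate of its endpoint is $\ell$. $S_r(x)=\frac{1-x-\sqrt{(1-x)^2-4(r-1)x}}{2(r-1)x}$ is the unique power series with $S_r=1+xS_r+(r-1)xS_r^2$. A Riordan array $(d(x),h(x))$ is the matrix with $(n,k)$-entry $[x^n]d(x)h(x)^k$. *)

(* Defs.v *)
From HB Require Import structures.
From mathcomp Require Import all_boot all_order all_algebra.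
From mathcomp Require Import boolp.
From mathcomp Require Import ring.

Set Implicit Arguments.
Unset Strict Implicit.
Unset Printing Implicit Defensive.

Import Order.TTheory GRing.Theory Num.Theory.
Local Open Scope ring_scope.

Section ColoredDyckPaths.
Variable r : nat.

(* [None] is an up-step u; [Some c] is a down-step d of color c. *)
Definition step : finType := option 'I_r.

Definition is_u (s : step) : bool := s == None.

Definition rise (s : step) : int := if is_u s then 1 else - 1.

Definition height (p : seq step) : int := \sum_(s <- p) rise s.

Definition dyck (p : seq step) : bool :=
  (height p == 0) && all (fun i => 0 <= height (take i p)) (iota 0 (size p)).

(* [sorted] constrains exactly the pairs of consecutive steps. *)
Definition no_dd_same_color (p : seq step) : bool :=
  sorted (fun s t : step => ~~ [&& ~~ is_u s, ~~ is_u t & s == t]) p.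

Definition A (n : nat) : {set (2 * n).-tuple step} :=
  [set p : (2 * n).-tuple step | dyck p && no_dd_same_color p].

(* The step in position i ends at the ordinate [height (take i.+1 p)]. *)
Definition u_steps_at (l : nat) m (p : m.-tuple step) : {set 'I_m} :=
  [set i : 'I_m | is_u (tnth p i) && (height (take i.+1 p) == l%:Z)].

Definition U (n l : nat) : nat := (\sum_(p in A n.+1) #|u_steps_at l.+1 p|)%N.

End ColoredDyckPaths.

(* Formal power series, as coefficient sequences. The wrapper avoids the
   pointwise ring structure on functions. *)
Record fps (R : Type) := Fps { coef : nat -> R }.

Section FpsRing.
Variable R : comNzRingType.

HB.instance Definition _ := gen_eqMixin (fps R).
HB.instance Definition _ := gen_choiceMixin (fps R).

Implicit Types f g h : fps R.

Lemma fpsP f g : (forall n, coef f n = coef g n) <-> f = g.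
Proof.
split=> [|-> //]; case: f => f; case: g => g /= E.
by congr Fps; apply/funext.
Qed.

Definition fps_zero : fps R := Fps (fun=> 0).
Definition fps_opp f : fps R := Fps (fun n => - coef f n).
Definition fps_add f g : fps R := Fps (fun n => coef f n + coef g n).
Definition fps_one : fps R := Fps (fun n => (n == 0%N)%:R).
Definition fps_mul f g : fps R :=
  Fps (fun n => \sum_(i < n.+1) coef f i * coef g (n - i)).

Fact fps_addA : associative fps_add.
Proof. by move=> f g h; apply/fpsP => n /=; rewrite addrA. Qed.
Fact fps_addC : commutative fps_add.
Proof. by move=> f g; apply/fpsP => n /=; rewrite addrC. Qed.
Fact fps_add0 : left_id fps_zero fps_add.
Proof. by move=> f; apply/fpsP => n /=; rewrite add0r. Qed.
Fact fps_addN : left_inverse fps_zero fps_opp fps_add.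
Proof. by move=> f; apply/fpsP => n /=; rewrite addNr. Qed.

HB.instance Definition _ :=
  GRing.isZmodule.Build (fps R) fps_addA fps_addC fps_add0 fps_addN.

Definition trunc N f : {poly R} := \poly_(i < N) coef f i.

Lemma coef_trunc N f i : (i < N)%N -> (trunc N f)`_i = coef f i.
Proof. by move=> lt_iN; rewrite coef_poly lt_iN. Qed.

Lemma coef_fps_mul_trunc N f g n : (n < N)%N ->
  coef (fps_mul f g) n = (trunc N f * trunc N g)`_n.
Proof.
move=> ltnN; rewrite coefM; apply: eq_bigr => i _.
rewrite !coef_trunc //; first exact: leq_ltn_trans (leq_subr _ _) ltnN.
by apply: leq_ltn_trans ltnN; rewrite -ltnS.
Qed.

Fact fps_mulC : commutative fps_mul.
Proof.
by move=> f g; apply/fpsP => n; rewrite !(@coef_fps_mul_trunc n.+1) // mulrC.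
Qed.

Fact fps_mulA : associative fps_mul.
Proof.
move=> f g h; apply/fpsP => n.
have -> : coef (fps_mul f (fps_mul g h)) n =
          (trunc n.+1 f * (trunc n.+1 g * trunc n.+1 h))`_n.
  rewrite coefM; apply: eq_bigr => i _.
  rewrite coef_trunc // -coef_fps_mul_trunc // ltnS; exact: leq_subr.
rewrite mulrA coefM; apply: eq_bigr => i _.
rewrite coef_trunc ?ltnS ?leq_subr //.
by rewrite -coef_fps_mul_trunc.
Qed.

Fact fps_mul1 : left_id fps_one fps_mul.
Proof.
move=> f; apply/fpsP => n /=.
rewrite big_ord_recl /= subn0 mul1r big1 ?addr0 // => i _.
by rewrite mul0r.
Qed.

Fact fps_mulDl : left_distributive fps_mul fps_add.
Proof.
move=> f g h; apply/fpsP => n /=.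
by rewrite -big_split; apply: eq_bigr => i _; rewrite mulrDl.
Qed.

Fact fps_one_neq0 : fps_one != 0 :> fps R.
Proof.
by apply/eqP => /(congr1 (fun f => coef f 0)) /= /eqP; rewrite oner_eq0.
Qed.

HB.instance Definition _ := GRing.Zmodule_isComNzRing.Build (fps R)
  fps_mulA fps_mulC fps_mul1 fps_mulDl fps_one_neq0.

Definition fpsC (c : R) : fps R := Fps (fun n => if n is 0%N then c else 0).
Definition fpsX : fps R := Fps (fun n => (n == 1%N)%:R).

Lemma coef_fps1 n : coef (1 : fps R) n = (n == 0%N)%:R. Proof. by []. Qed.
Lemma coef_fpsD f g n : coef (f + g) n = coef f n + coef g n. Proof. by []. Qed.
Lemma coef_fpsN f n : coef (- f) n = - coef f n. Proof. by []. Qed.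
Lemma coef_fpsM f g n :
  coef (f * g) n = \sum_(i < n.+1) coef f i * coef g (n - i).
Proof. by []. Qed.

Lemma coef_fpsCM c f n : coef (fpsC c * f) n = c * coef f n.
Proof.
rewrite coef_fpsM big_ord_recl /= subn0 big1 ?addr0 // => i _.
by rewrite mul0r.
Qed.

Lemma coef_fpsXM f n : coef (fpsX * f) n = if n is m.+1 then coef f m else 0.
Proof.
rewrite coef_fpsM; case: n => [|n]; first by rewrite big_ord1 /= mul0r.
rewrite !big_ord_recl /= mul0r mul1r add0r subSS subn0 big1 ?addr0 // => i _.
by rewrite mul0r.
Qed.

Definition riordan (d h : fps R) (n k : nat) : R := coef (d * h ^+ k) n.

End FpsRing.

Arguments fpsX {R}.

Section SeriesS.
Variable r : nat.

Let c : rat := r%:R - 1.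

Definition S_step (f : fps rat) : fps rat :=
  1 + fpsX * f + fpsC c * fpsX * f ^+ 2.

(* S_r is the fixed point of [S_step]: each iteration fixes one more
   coefficient. See [Sr_eq], [Sr_unique] and [Sr_closed_form]. *)
Definition Sr : fps rat := Fps (fun n => coef (iter n.+1 S_step 0) n).

Lemma coef_S_step f n : coef (S_step f) n =
  if n is m.+1 then coef f m + c * \sum_(i < m.+1) coef f i * coef f (m - i)
  else 1.
Proof.
rewrite /S_step !coef_fpsD -mulrA expr2 coef_fpsCM !coef_fpsXM coef_fps1.
case: n => [|n] /=; first by rewrite mulr0 !addr0.
by rewrite add0r.
Qed.

Lemma S_step_cont f g n : (forall i, (i < n)%N -> coef f i = coef g i) ->
  forall i, (i < n.+1)%N -> coef (S_step f) i = coef (S_step g) i.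
Proof.
move=> E [|i] lt_in; rewrite !coef_S_step // E //; congr (_ + _ * _).
apply: eq_bigr => j _.
have le_ji : (j <= i)%N by rewrite -ltnS.
rewrite ltnS in lt_in.
rewrite (E j) ?(E (i - j)%N) //; first exact: leq_ltn_trans (leq_subr _ _) lt_in.
exact: leq_ltn_trans le_ji lt_in.
Qed.

Lemma iter_S_step f g n i : (i < n)%N ->
  coef (iter n S_step f) i = coef (iter n S_step g) i.
Proof.
by elim: n i => [//|n IHn] i lt_in /=; apply: S_step_cont lt_in.
Qed.

Lemma coef_Sr n m : (n < m)%N -> coef Sr n = coef (iter m S_step 0) n.
Proof.
move=> lt_nm; rewrite -(subnKC lt_nm) iterD; exact: iter_S_step.
Qed.

Lemma Sr_eq : Sr = 1 + fpsX * Sr + fpsC (r%:R - 1) * fpsX * Sr ^+ 2.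
Proof.
apply/fpsP => n; rewrite (@coef_Sr n n.+1) // iterS.
by apply: (@S_step_cont _ _ n) => // i lt_in; rewrite (coef_Sr lt_in).
Qed.

Lemma Sr_unique (f : fps rat) :
  f = 1 + fpsX * f + fpsC (r%:R - 1) * fpsX * f ^+ 2 -> f = Sr.
Proof.
move=> fE; have fix_f m : f = iter m S_step f.
  by elim: m => //= m <-.
by apply/fpsP => n; rewrite (fix_f n.+1); apply: iter_S_step.
Qed.

(* The square root of (1 - x)^2 - 4(r - 1)x with constant term 1 is
   1 - x - 2(r - 1)x S_r(x). *)
Lemma Sr_closed_form :
  let q := 1 - fpsX - 2 * fpsC (r%:R - 1) * fpsX * Sr in
  coef q 0 = 1 /\ q ^+ 2 = (1 - fpsX) ^+ 2 - 4 * fpsC (r%:R - 1) * fpsX.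
Proof.
split.
  rewrite !coef_fpsD !coef_fpsN coef_fps1 -mulrA [_ * (_ * _)]mulrC -mulrA.
  by rewrite coef_fpsXM /= !subr0.
set d := fpsC _; have E : Sr - (1 + fpsX * Sr + d * fpsX * Sr ^+ 2) = 0.
  by rewrite -Sr_eq subrr.
rewrite -[LHS]addr0 -[X in _ + X](mulr0 (4 * d * fpsX)) -E; ring.
Qed.

End SeriesS.

(* Main.v *)
(* Both halves of a path around a marked u-step are counted by power series.
   Write c = r - 1 and let S be the solution of S = 1 + xS(1 + cS).  With t
   marking steps and x = t^2, the prefixes from level 0 to level h have the
   generating function t^h S^(h+1), and the suffixes from level h + 1 that
   follow a u-step have t^(h+1) (1 + cS) S (cS)^h: both families of series
   solve the linear recurrence obtained by cutting off one extremal step.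
   Cutting each path at its marked u-step multiplies the two at h = l, which
   is the Riordan array.
   The closed form for [x^m] S^k follows since it satisfies the recurrence
   S^(k+1) = S^k + x S^(k+1) + c x S^(k+2). *)
From HB Require Import structures.
Require Import Defs.
From mathcomp Require Import all_boot all_order all_algebra.
From mathcomp Require Import ring zify.

Set Implicit Arguments.
Unset Strict Implicit.
Unset Printing Implicit Defensive.

Import Order.TTheory GRing.Theory Num.Theory.
Local Open Scope ring_scope.

(** * Sums over words of a fixed length *)

Section WordSums.
Variables (T : finType) (V : nmodType).
Implicit Types (F : seq T -> V) (m n : nat).

(** Words are plain sequences here, so they can be cut at either end or at any position without
    casts between tuple types. *)
Fixpoint wsum m F : V :=
  if m is m'.+1 then \sum_(s : T) wsum m' (fun w => F (s :: w)) else F [::].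

Lemma eq_in_wsum m F G : (forall w, size w = m -> F w = G w) -> wsum m F = wsum m G.
Proof.
elim: m F G => [|m IHm] F G E /=; first exact: E.
by apply: eq_bigr => s _; apply: IHm => w sz; apply: E; rewrite /= sz.
Qed.

Lemma eq_wsum m F G : F =1 G -> wsum m F = wsum m G.
Proof. by move=> E; apply: eq_in_wsum. Qed.

Lemma wsum0 m : wsum m (fun=> 0) = 0.
Proof. by elim: m => //= m IHm; rewrite big1. Qed.

Lemma wsumD m F G : wsum m (fun w => F w + G w) = wsum m F + wsum m G.
Proof.
elim: m F G => //= m IHm F G.
by rewrite -big_split; apply: eq_bigr => s _; apply: IHm.
Qed.

Lemma wsum_cat m n F :
  wsum (m + n) F = wsum m (fun u => wsum n (fun v => F (u ++ v))).
Proof.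
elim: m F => //= m IHm F.
by apply: eq_bigr => s _; rewrite IHm.
Qed.

Lemma wsum_rcons m F :
  wsum m.+1 F = wsum m (fun u => \sum_(s : T) F (rcons u s)).
Proof.
rewrite -addn1 wsum_cat; apply: eq_wsum => u /=.
by apply: eq_bigr => s _; rewrite cats1.
Qed.

Lemma sum_tuple_wsum m F : \sum_(p : m.-tuple T) F p = wsum m F.
Proof.
elim: m F => [|m IHm] F /=.
  by rewrite (big_pred1 [tuple]) // => p; apply/esym/eqP/tuple0.
transitivity (\sum_(sp : T * m.-tuple T) F (sp.1 :: sp.2)).
  rewrite (reindex (fun sp : T * m.-tuple T => [tuple of sp.1 :: sp.2])) //=.
  exists (fun p => (thead p, [tuple of behead p])) => [[s p] _|p _] /=.
    by congr (_, _); apply: val_inj.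
  by rewrite -tuple_eta.
rewrite -(pair_bigA _ (fun s (p : m.-tuple T) => F (s :: p))) /=.
by apply: eq_bigr => s _; rewrite -IHm.
Qed.

End WordSums.

Lemma wsumZ (T : finType) (R : pzSemiRingType) m (a : R) (F : seq T -> R) :
  wsum m (fun w => a * F w) = a * wsum m F.
Proof.
elim: m F => //= m IHm F.
by rewrite mulr_sumr; apply: eq_bigr => s _; rewrite IHm.
Qed.

(** * The substitution x = t^2 in power series *)

Section Dilation.
Variable R : comNzRingType.
Implicit Types f g : fps R.

(** This is f(t^2): t marks single steps, whereas x in [Sr] marks pairs of steps. *)
Definition dil f : fps R := Fps (fun n => if odd n then 0 else coef f n./2).

Lemma trunc_dil N f : trunc N.*2 (dil f) = trunc N f \Po 'X^2.
Proof.
apply/polyP => i; rewrite coef_comp_poly_Xn // !coef_poly /= dvdn2 divn2.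
case: (boolP (odd i)) => odd_i /=; first by rewrite if_same.
by rewrite -[in RHS]ltn_double even_halfK.
Qed.

Fact dil_is_zmod_morphism : zmod_morphism dil.
Proof.
move=> f g; apply/fpsP => n /=.
by case: odd; rewrite ?subr0.
Qed.

(** On truncations the substitution is polynomial composition with X^2, which is multiplicative. *)
Fact dil_is_monoid_morphism : monoid_morphism dil.
Proof.
split=> [|f g]; apply/fpsP => n; first by case: n => [|[|n]] //=; case: ifP.
have lt_n : (n < n.+1.*2)%N by lia.
rewrite -[dil f * _]/(fps_mul _ _) (coef_fps_mul_trunc _ _ lt_n) !trunc_dil.
rewrite -comp_polyM coef_comp_poly_Xn // dvdn2 divn2 /=; case: odd => //=.
rewrite -[LHS]/(coef (fps_mul f g) n./2) (@coef_fps_mul_trunc _ n.+1) //.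
by lia.
Qed.

HB.instance Definition _ :=
  GRing.isZmodMorphism.Build (fps R) (fps R) dil dil_is_zmod_morphism.
HB.instance Definition _ :=
  GRing.isMonoidMorphism.Build (fps R) (fps R) dil dil_is_monoid_morphism.

Lemma dilX : dil fpsX = fpsX ^+ 2.
Proof.
apply/fpsP => n; rewrite expr2 coef_fpsXM.
by case: n => [|[|[|[|n]]]] //=; rewrite if_same.
Qed.

Lemma dilC c : dil (fpsC c) = fpsC c.
Proof. by apply/fpsP => -[|[|n]] //=; case: odd. Qed.

Lemma coef_dil_double f n : coef (dil f) n.*2 = coef f n.
Proof. by rewrite /= odd_double doubleK. Qed.

End Dilation.

(** * Paths from an arbitrary level, and cutting at a u-step *)

Section Paths.
Variable r : nat.
Local Notation step := (step r).
Implicit Types (p u v : seq step) (s : step) (h : int).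

Definition compatible (s t : step) : bool := ~~ [&& ~~ is_u s, ~~ is_u t & s == t].

Lemma compatibleN s : compatible s None.
Proof. by rewrite /compatible /= andbF. Qed.

Fixpoint above h p : bool :=
  (0 <= h) && if p is s :: p' then above (h + rise s) p' else true.

Lemma height_nil : height ([::] : seq step) = 0.
Proof. exact: big_nil. Qed.

Lemma height_cons s p : height (s :: p) = rise s + height p.
Proof. exact: big_cons. Qed.

Lemma height_cat u v : height (u ++ v) = height u + height v.
Proof. exact: big_cat. Qed.

Lemma height_rcons u s : height (rcons u s) = height u + rise s.
Proof. by rewrite -cats1 height_cat height_cons height_nil addr0. Qed.

Lemma above_ge0 h p : above h p -> 0 <= h.
Proof. by case: p => [|s p] /= /andP[]. Qed.

Lemma aboveE h p :
  above h p = all (fun i => 0 <= h + height (take i p)) (iota 0 (size p).+1).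
Proof.
elim: p h => [|s p IHp] h /=; first by rewrite height_nil addr0.
rewrite height_nil addr0 IHp (iotaDl 1 1) all_map /= height_cons take0 height_nil.
rewrite !addr0; congr [&& _, _ & _].
by apply: eq_all => i /=; rewrite height_cons addrA.
Qed.

Lemma above_cat h u v : above h (u ++ v) = above h u && above (h + height u) v.
Proof.
elim: u h => [|s u IHu] h /=.
  rewrite height_nil addr0 andbT; apply/idP/andP => [hv|[]//].
  by split=> //; apply: above_ge0 hv.
by rewrite IHu height_cons addrA andbA.
Qed.

Lemma above_rcons h u s : above h (rcons u s) = above h u && (0 <= h + height u + rise s).
Proof.
rewrite -cats1 above_cat /= andbT; case: (boolP (above h u)) => //= hu.
have: above h (u ++ [::]) by rewrite cats0.
by rewrite above_cat => /andP[_ /= /andP[-> _]].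
Qed.

(** [above] also tests the endpoint of the whole path, which [dyck] leaves to the condition that the
    height is 0. *)
Lemma dyckE p : dyck p = above 0 p && (height p == 0).
Proof.
rewrite /dyck aboveE andbC -addn1 iotaD all_cat /= add0n take_size andbT.
case: eqP => [->|]; rewrite ?andbF ?andbT //.
by apply: eq_all => i; rewrite add0r.
Qed.

(** A virtual u-step in front imposes no constraint and gives every step a predecessor. *)
Lemma no_ddE p : no_dd_same_color p = path compatible None p.
Proof. by case: p. Qed.

Definition prefix_ok u : bool := above 0 u && path compatible None u.

(* A continuation to level 0 from level [h] after the step [s]. *)
Definition suffix_ok s h v : bool :=
  [&& above h v, path compatible s v & h + height v == 0].

(** A u-step is compatible with both of its neighbors, so the color condition splits at the cut as
    well as the height condition. *)
Lemma valid_cut u v :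
  dyck (u ++ None :: v) && no_dd_same_color (u ++ None :: v) =
  prefix_ok u && suffix_ok None (height u + 1) v.
Proof.
rewrite dyckE no_ddE above_cat cat_path /= compatibleN /= add0r.
rewrite height_cat height_cons addrA /prefix_ok /suffix_ok /=.
case: (boolP (above 0 u)) => //= hu.
(* The start of the marked step is the endpoint of [u], so its level is already known to be
   nonnegative. *)
have := hu; rewrite -[u]cats0 above_cat cats0 add0r => /andP[_ /= /andP[-> _]] /=.
by case: (path _ None u); case: (path _ None v); case: above; case: (_ == 0).
Qed.

Lemma suffix_ok_cons s h t v :
  suffix_ok s h (t :: v) = [&& 0 <= h, compatible s t & suffix_ok t (h + rise t) v].
Proof.
rewrite /suffix_ok /= height_cons addrA -!andbA; congr (_ && _).
by rewrite andbCA.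
Qed.

Lemma prefix_ok_rcons u s :
  prefix_ok (rcons u s) =
  [&& prefix_ok u, compatible (last None u) s & 0 <= height u + rise s].
Proof.
rewrite /prefix_ok above_rcons rcons_path add0r -!andbA; congr (_ && _).
by rewrite andbC -andbA.
Qed.

Lemma suffix_ok_lt0 s h v : h < 0 -> suffix_ok s h v = false.
Proof.
by move=> h0; apply/negP => /and3P[/above_ge0]; rewrite leNgt h0.
Qed.

End Paths.

(** * The series S in the variable t, and admissible colors *)

Section Counting.
Variable r : nat.
Local Notation step := (step r).
Local Notation c := (r%:R - 1 : rat).
Local Notation C := (fpsC c).
Local Notation s := (dil (Sr r)).
Local Notation t := (fpsX : fps rat).

Lemma dil_Sr_eq : s = 1 + t ^+ 2 * s + C * t ^+ 2 * s ^+ 2.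
Proof.
rewrite [in LHS](Sr_eq r) !rmorphD /= !rmorphM /= rmorph1.
by rewrite dilX dilC.
Qed.

Lemma sum_step (F : step -> rat) : \sum_x F x = F None + \sum_(i < r) F (Some i).
Proof.
rewrite (bigD1 None) //=; congr (_ + _).
rewrite (reindex_omap (Some : 'I_r -> step) id) /=; last by case.
by apply: eq_bigl => i; rewrite eqxx.
Qed.

(** A d-step may take r - 1 colors after a d-step, but all r colors after a u-step. *)
Lemma sum_compatible (x : step) :
  \sum_(i < r) (compatible x (Some i))%:R = c + (x == None)%:R :> rat.
Proof.
case: x => [j|] /=; last first.
  by rewrite subrK; under eq_bigr do rewrite /compatible /=; rewrite sumr_const card_ord.
rewrite addr0 (bigD1 j) //= /compatible /= eqxx add0r.
rewrite (eq_bigr (fun=> 1)) => [|i /negPf ne_ij]; last first.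
  by rewrite (inj_eq Some_inj) eq_sym ne_ij.
by rewrite sumr_const cardC1 card_ord -subn1 natrB // (leq_ltn_trans (leq0n _) (ltn_ord j)).
Qed.

(** * Prefixes before the marked step *)

Definition prefix_gf (h : nat) : fps rat := t ^+ h * s ^+ h.+1.
(** The series for prefixes that are empty or end with u; they are tracked apart because a d-step
    after them has one more color. *)
Definition prefix_u_gf (h : nat) : fps rat := t ^+ h * s ^+ h.

Lemma prefix_gf_rec h :
  prefix_gf h = prefix_u_gf h + t * (C * prefix_gf h.+1 + prefix_u_gf h.+1).
Proof.
rewrite /prefix_gf /prefix_u_gf !exprS [X in _ * (X * _)]dil_Sr_eq.
ring.
Qed.

Lemma prefix_u_gf_rec h : prefix_u_gf h.+1 = t * prefix_gf h.
Proof. by rewrite /prefix_u_gf /prefix_gf exprS mulrA. Qed.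

Definition prefix_count m (h : nat) : rat :=
  wsum m (fun u : seq step => (prefix_ok u && (height u == h%:Z))%:R).

(* The default value of [last] makes the empty prefix count as ending with u. *)
Definition prefix_u_count m (h : nat) : rat :=
  wsum m (fun u : seq step =>
    ([&& prefix_ok u, height u == h%:Z & last None u == None])%:R).

Lemma prefix_u_count_rec m h :
  prefix_u_count m.+1 h = if h is h'.+1 then prefix_count m h' else 0.
Proof.
rewrite /prefix_u_count wsum_rcons.
rewrite (@eq_wsum _ _ _ _ (fun u : seq step => (prefix_ok u && (height u + 1 == h%:Z))%:R)).
  (* A u-step ending at level 0 would start at level -1. *)
  case: h => [|h].
    rewrite -[RHS](wsum0 step rat m); apply: eq_wsum => u.
    case: (boolP (prefix_ok u)) => //= /andP[+ _].
    rewrite -[u]cats0 above_cat cats0 add0r => /andP[_ /= /andP[u0 _]].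
    by case: eqP => // E; lia.
  by apply: eq_wsum => u; congr ((_ && _)%:R : rat); lia.
move=> u; rewrite sum_step big1 => [|i _].
  rewrite addr0 prefix_ok_rcons compatibleN height_rcons last_rcons eqxx andbT /=.
  rewrite -andbA; congr ((_ && _)%:R : rat).
  by apply/andP/eqP => [[_ /eqP//]|E]; rewrite /rise /=; split; [lia|apply/eqP].
by rewrite last_rcons !andbF.
Qed.

(** The last step is u, or it is d from level h + 1, with r - 1 colors in every case and one more if
    the step before it is not d. *)
Lemma prefix_count_rec m h :
  prefix_count m.+1 h =
  prefix_u_count m.+1 h + (c * prefix_count m h.+1 + prefix_u_count m h.+1).
Proof.
rewrite /prefix_count /prefix_u_count -wsumZ -wsumD !wsum_rcons -wsumD.
apply: eq_wsum => u; rewrite !sum_step !last_rcons eqxx !andbT.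
rewrite [X in _ = _ + X + _]big1 ?addr0 => [|i _]; last first.
  by rewrite last_rcons !andbF.
congr (_ + _).
rewrite (eq_bigr (fun i => (prefix_ok u && (height u == h.+1%:Z))%:R *
   (compatible (last None u) (Some i))%:R)) => [|i _]; last first.
  rewrite prefix_ok_rcons height_rcons -natrM mulnb /rise /=.
  case: (prefix_ok u) => //=; case: (compatible _ _); rewrite ?andbF //= andbT.
  congr ((nat_of_bool _)%:R : rat); apply/andP/eqP => [[_ /eqP]|E]; [lia|split; [lia|apply/eqP; lia]].
rewrite -mulr_sumr sum_compatible mulrDr [c * _]mulrC; congr (_ + _).
by rewrite -natrM mulnb andbA.
Qed.

Lemma prefix_countE m h :
  prefix_count m h = coef (prefix_gf h) m /\ prefix_u_count m h = coef (prefix_u_gf h) m.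
Proof.
elim: m h => [|m IHm] h.
  have u0 h' : coef (prefix_u_gf h') 0 = (h' == 0%N)%:R.
    case: h' => [|h']; first by rewrite /prefix_u_gf mul1r.
    by rewrite prefix_u_gf_rec coef_fpsXM.
  split; last first.
    by rewrite u0 /prefix_u_count /= /prefix_ok /= height_nil; case: h.
  rewrite prefix_gf_rec coef_fpsD coef_fpsXM addr0 u0.
  by rewrite /prefix_count /= /prefix_ok /= height_nil; case: h.
(* The recurrence for [prefix_count] uses this value at the same length m + 1, so it is settled
   first. *)
have uE : prefix_u_count m.+1 h = coef (prefix_u_gf h) m.+1.
  rewrite prefix_u_count_rec; case: h => [|h]; first by rewrite /prefix_u_gf mul1r.
  by rewrite prefix_u_gf_rec coef_fpsXM (IHm h).1.
split=> //; rewrite prefix_count_rec uE prefix_gf_rec coef_fpsD coef_fpsXM; congr (_ + _).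
by rewrite coef_fpsD coef_fpsCM (IHm _).1 (IHm _).2.
Qed.

(** * Suffixes after a given step *)

Definition suffix_d_gf (h : nat) : fps rat := t ^+ h * (C ^+ h * s ^+ h.+1).
(** From level 0 only a u-step can follow, so there the series agrees with [suffix_d_gf]. *)
Definition suffix_u_gf (h : nat) : fps rat :=
  if h is h'.+1 then t ^+ h * ((1 + C * s) * s * (C * s) ^+ h') else s.
(** By symmetry the color of a preceding d-step does not affect the count. *)
Definition suffix_gf (x : step) : nat -> fps rat :=
  if x is None then suffix_u_gf else suffix_d_gf.

Lemma suffix_gf0 x : suffix_gf x 0 = 1 + t * suffix_u_gf 1.
Proof.
have -> : suffix_gf x 0 = s by case: x => [?|] //=; rewrite /suffix_d_gf !expr0 !mul1r.
by rewrite /suffix_u_gf [in LHS]dil_Sr_eq; ring.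
Qed.

Lemma suffix_gfS (x : step) h :
  suffix_gf x h.+1 =
  t * suffix_u_gf h.+2 + t * ((C + (x == None)%:R) * suffix_d_gf h).
Proof.
case: x => [i|] /=; rewrite /suffix_u_gf /suffix_d_gf !exprMn !exprS ?addr0.
  by rewrite [X in _ * (_ * (X * _)) = _]dil_Sr_eq; ring.
rewrite mulr1n.
(* The part 1 + C yields the r colors of a following d-step, the rest a following u-step. *)
rewrite {1}(_ : 1 + C * s = 1 + C + C * (t ^+ 2 * s + C * t ^+ 2 * s ^+ 2)); last first.
  by rewrite [X in _ + _ * X = _]dil_Sr_eq; ring.
ring.
Qed.

Definition suffix_count m (x : step) (h : nat) : rat :=
  wsum m (fun v => (suffix_ok x h%:Z v)%:R).

Lemma suffix_count_rec m x h :
  suffix_count m.+1 x h = suffix_count m None h.+1 +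
  if h is h'.+1 then \sum_(i < r) (compatible x (Some i))%:R * suffix_count m (Some i) h'
  else 0.
Proof.
rewrite /suffix_count /= sum_step; congr (_ + _).
  apply: eq_wsum => v; rewrite suffix_ok_cons compatibleN /=.
  by congr ((suffix_ok _ _ _)%:R : rat); rewrite /rise /=; lia.
case: h => [|h].
  rewrite big1 // => i _; rewrite -[RHS](wsum0 step rat m); apply: eq_wsum => v.
  by rewrite suffix_ok_cons [suffix_ok (Some i) _ _]suffix_ok_lt0 ?andbF.
apply: eq_bigr => i _; rewrite -wsumZ; apply: eq_wsum => v.
rewrite suffix_ok_cons -natrM mulnb /=; congr ((_ && suffix_ok _ _ _)%:R : rat).
by rewrite /rise /=; lia.
Qed.

Lemma suffix_countE m x h : suffix_count m x h = coef (suffix_gf x h) m.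
Proof.
elim: m x h => [|m IHm] x h.
  rewrite /suffix_count /= /suffix_ok /= height_nil addr0.
  case: h => [|h]; first by rewrite suffix_gf0 coef_fpsD coef_fpsXM addr0.
  by case: x => [i|]; rewrite /suffix_gf /suffix_u_gf /suffix_d_gf exprS -!mulrA coef_fpsXM.
rewrite suffix_count_rec; case: h => [|h].
  by rewrite suffix_gf0 coef_fpsD coef_fpsXM IHm coef_fps1 addr0 add0r.
rewrite suffix_gfS coef_fpsD !coef_fpsXM IHm; congr (_ + _).
under eq_bigr do rewrite IHm.
rewrite -mulr_suml sum_compatible mulrDl [X in coef X _]mulrDl coef_fpsD coef_fpsCM.
by congr (_ + _); case: (x == None); rewrite ?mul0r ?mul1r.
Qed.

(** * Convolution at the marked step *)

Lemma U_prefix_suffix n l :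
  (U r n l)%:R =
  \sum_(i < 2 * n.+1) prefix_count i l * suffix_count (2 * n.+1 - i.+1) None l.+1.
Proof.
pose marked (p : seq step) i :=
  [&& dyck p && no_dd_same_color p, is_u (nth None p i) &
      height (take i.+1 p) == l.+1%:Z].
transitivity (\sum_(p : (2 * n.+1).-tuple step) \sum_(i < 2 * n.+1) (marked p i)%:R : rat).
  rewrite /U natr_sum big_mkcond; apply: eq_bigr => p _.
  rewrite inE /marked; case: ifP => _ /=; last by rewrite big1.
  rewrite -sum1dep_card natr_sum big_mkcond; apply: eq_bigr => i _.
  by rewrite (tnth_nth None); case: ifP.
(* Double counting: with the position fixed first, the paths split into independent prefixes and
   suffixes. *)
rewrite exchange_big; apply: eq_bigr => i _.
rewrite (sum_tuple_wsum _ (fun p => (marked p i)%:R)).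
have {1}-> : (2 * n.+1 = i + (2 * n.+1 - i.+1).+1)%N by have := ltn_ord i; lia.
rewrite wsum_cat /prefix_count mulrC -wsumZ; apply: eq_in_wsum => u szu.
rewrite /= sum_step [X in _ + X]big1 ?addr0 => [|j _]; last first.
  rewrite -[RHS](wsum0 step rat (2 * n.+1 - i.+1)); apply: eq_wsum => v.
  by rewrite /marked nth_cat szu ltnn subnn /= andbF.
rewrite mulrC /suffix_count -wsumZ; apply: eq_wsum => v.
rewrite /marked valid_cut nth_cat szu ltnn subnn /=.
rewrite -cat_rcons take_size_cat ?size_rcons ?szu // height_rcons.
have -> : (height u + rise None == l.+1%:Z) = (height u == l%:Z) by rewrite /rise /=; lia.
rewrite -natrM mulnb; case: eqP => [->|_]; rewrite ?andbF //= !andbT.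
by congr ((_ && suffix_ok _ _ _)%:R : rat); lia.
Qed.

(** The two halves have 2n + 1 steps in total, the marked step being in neither. Their product is t
    times a series in t^2, so this odd coefficient is the coefficient of x^n. *)
Lemma U_riordan n l :
  (U r n l)%:R =
  riordan (Sr r ^+ 2 * (1 + C * Sr r)) (t * C * Sr r ^+ 2) n l.
Proof.
have -> : riordan (Sr r ^+ 2 * (1 + C * Sr r)) (t * C * Sr r ^+ 2) n l =
          coef (prefix_gf l * suffix_u_gf l.+1) n.*2.+1.
  have -> : prefix_gf l * suffix_u_gf l.+1 =
            t * dil (Sr r ^+ 2 * (1 + C * Sr r) * (t * C * Sr r ^+ 2) ^+ l).
    rewrite /prefix_gf /suffix_u_gf rmorphM rmorphXn !rmorphM rmorphD rmorph1 !rmorphM.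
    by rewrite /= dilX dilC expr2 !exprMn !exprS; ring.
  by rewrite coef_fpsXM coef_dil_double.
rewrite U_prefix_suffix coef_fpsM -mul2n mulnS.
apply: eq_bigr => i _; rewrite (prefix_countE _ _).1 suffix_countE.
by congr (_ * coef _ _); lia.
Qed.

(** * Coefficients of the powers of S *)

Lemma Sr_expS_rec k : Sr r ^+ k.+1 = Sr r ^+ k + t * (Sr r ^+ k.+1 + C * Sr r ^+ k.+2).
Proof. by rewrite !exprS [X in X * _ = _]Sr_eq; ring. Qed.

(* The coefficient of [c ^+ i] in the coefficient of [x^m] in [Sr r ^+ k];
   for [m = k = 0] it is a junk value. *)
Definition Sr_exp_term (m k i : nat) : rat :=
  'C(m, i)%:R * (k%:R / (m + i + k)%:R * 'C(m + i + k, m)%:R).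

Lemma fact_neq0 m : m`!%:R != 0 :> rat.
Proof. by rewrite pnatr_eq0 -lt0n fact_gt0. Qed.

(** The denominator N + 1 cancels the top factor of (N + 1)!; writing m = i + j avoids truncated
    subtraction. *)
Lemma Sr_exp_term_fact k i j N : (i + j + i + k = N.+1)%N ->
  Sr_exp_term (i + j) k i = k%:R * N`!%:R / (i`!%:R * j`!%:R * (i + k)`!%:R).
Proof.
have binE a b : 'C(a + b, a)%:R = (a + b)`!%:R / (a`!%:R * b`!%:R) :> rat.
  rewrite -(bin_fact (leq_addr b a)) addKn !natrM; field.
  by rewrite !fact_neq0.
move=> NE; rewrite /Sr_exp_term binE -addnA binE addnA NE factS natrM.
by field; rewrite !fact_neq0 /= nat1r pnatr_eq0.
Qed.

Lemma Sr_exp_term_small m k i : (m < i)%N -> Sr_exp_term m k i = 0.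
Proof. by move=> lt_mi; rewrite /Sr_exp_term bin_small // mul0r. Qed.

(** With [Sr_exp_termS], this is [Sr_expS_rec] compared coefficientwise in x and c; the summand with
    factor c contributes nothing to c^0. *)
Lemma Sr_exp_term0 m k :
  Sr_exp_term m.+1 k.+1 0 = Sr_exp_term m.+1 k 0 + Sr_exp_term m k.+1 0.
Proof.
rewrite (@Sr_exp_term_fact k.+1 0 m.+1 (m + k).+1); last by lia.
rewrite (@Sr_exp_term_fact k 0 m.+1 (m + k)); last by lia.
rewrite (@Sr_exp_term_fact k.+1 0 m (m + k)); last by lia.
rewrite !add0n !factS !natrM; field.
by rewrite !fact_neq0 -?natrD ?nat1r ?pnatr_eq0.
Qed.

Lemma Sr_exp_termS m k i :
  Sr_exp_term m.+1 k.+1 i.+1 =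
  Sr_exp_term m.+1 k i.+1 + Sr_exp_term m k.+1 i.+1 + Sr_exp_term m k.+2 i.
Proof.
(* For i < m all four terms have factorial form, for i > m all vanish, and for i = m only the third
   one vanishes. *)
case: (ltngtP i m) => [lt_im|lt_mi|->].
- have [j ->] : exists j, m = (i.+1 + j)%N by exists (m - i.+1)%N; rewrite subnKC.
  rewrite -addnS (@Sr_exp_term_fact k.+1 i.+1 j.+1 (i + i + j + k).+3); last by lia.
  rewrite (@Sr_exp_term_fact k i.+1 j.+1 (i + i + j + k).+2); last by lia.
  rewrite (@Sr_exp_term_fact k.+1 i.+1 j (i + i + j + k).+2); last by lia.
  rewrite [(i.+1 + j)%N]addSnnS (@Sr_exp_term_fact k.+2 i j.+1 (i + i + j + k).+2); last by lia.
  rewrite [(_ + j + k).+3`!]factS !addSn !addnS !(factS i) !(factS j) !(factS (i + k)).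
  rewrite !(factS (i + k).+1) !(factS (i + k)) !natrM; field.
  by rewrite !fact_neq0 -?natrD ?nat1r ?pnatr_eq0.
- by rewrite !Sr_exp_term_small ?addr0 // ltnW.
rewrite [X in _ + X + _]Sr_exp_term_small // addr0.
have diag a b N : (b + b + a = N.+1)%N ->
    Sr_exp_term b a b = a%:R * N`!%:R / (b`!%:R * 0`!%:R * (b + a)`!%:R).
  by have := @Sr_exp_term_fact a b 0 N; rewrite addn0.
rewrite (diag k.+1 m.+1 (m + m + k).+2); last by lia.
rewrite (diag k m.+1 (m + m + k).+1); last by lia.
rewrite (diag k.+2 m (m + m + k).+1); last by lia.
rewrite [(_ + k).+2`!]factS !addSn !addnS !(factS (m + k).+1) !(factS (m + k)) !(factS m).
rewrite !natrM; field.
by rewrite !fact_neq0 -?natrD ?nat1r ?pnatr_eq0.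
Qed.

(** Induction on m, then on k, along [Sr_expS_rec]: the summand S^k comes from the inner hypothesis,
    the summands with a factor x from the outer one. For m = k = 0 the right side would be 0 because
    of 0 / 0, but the coefficient is 1. *)
Lemma coef_Sr_exp m k : (0 < m + k)%N ->
  coef (Sr r ^+ k) m = \sum_(i < m.+1) Sr_exp_term m k i * c ^+ i.
Proof.
elim: m k => [|m IHm] k k_gt0.
  rewrite big_ord1 /Sr_exp_term /= !bin0 mul1r !add0n !mulr1 divff ?pnatr_eq0 -?lt0n //.
  elim: k {k_gt0} => // k IHk.
  by rewrite Sr_expS_rec coef_fpsD coef_fpsXM addr0.
elim: k {k_gt0} => [|k IHk].
  by rewrite big1 // => i _; rewrite /Sr_exp_term !mul0r mulr0 mul0r.
rewrite Sr_expS_rec coef_fpsD coef_fpsXM coef_fpsD coef_fpsCM IHk ?addnS // !IHm ?addnS //.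
have split0 (F : nat -> rat) :
    \sum_(i < m.+2) F i * c ^+ i = F 0 + \sum_(i < m.+1) F i.+1 * c ^+ i.+1.
  by rewrite big_ord_recl mulr1.
rewrite (split0 (Sr_exp_term m.+1 k)) (split0 (Sr_exp_term m.+1 k.+1)).
(* Padding with the vanishing term i = m + 1 gives this sum the same range as the others once c^0 is
   split off. *)
have -> : \sum_(i < m.+1) Sr_exp_term m k.+1 i * c ^+ i =
    Sr_exp_term m k.+1 0 + \sum_(i < m.+1) Sr_exp_term m k.+1 i.+1 * c ^+ i.+1.
  transitivity (\sum_(i < m.+2) Sr_exp_term m k.+1 i * c ^+ i).
    by rewrite [RHS]big_ord_recr /= Sr_exp_term_small // mul0r addr0.
  exact: split0.
rewrite Sr_exp_term0 mulr_sumr.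
under [in RHS]eq_bigr do rewrite Sr_exp_termS !mulrDl.
rewrite !big_split /=.
under [X in _ = _ + (_ + X)]eq_bigr do rewrite exprS mulrCA.
by ring.
Qed.

End Counting.

(** * Extraction of the closed form *)

Lemma coef_fpsXnM (R : comNzRingType) (f : fps R) l m :
  coef (fpsX ^+ l * f) (l + m) = coef f m.
Proof. by elim: l => [|l IHl]; rewrite ?mul1r // exprS -mulrA coef_fpsXM. Qed.

Lemma coef_fpsCnM (R : comNzRingType) (a : R) (f : fps R) l m :
  coef (fpsC a ^+ l * f) m = a ^+ l * coef f m.
Proof.
elim: l => [|l IHl]; first by rewrite !mul1r.
by rewrite !exprS -!mulrA coef_fpsCM IHl.
Qed.

Theorem theorem4p1 (r : nat) (hr : (2 <= r)%N) :
  [/\ forall n l : nat, (l <= n)%N ->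
        (U r n l)%:R =
        \sum_(0 <= j < (n - l).+1)
          'C(n - l, j)%:R *
          ((2 * l + 2)%:R / (2 * n - j + 2)%:R * 'C(2 * n - j + 2, n - l)%:R
           + (2 * l + 3)%:R * (r%:R - 1) / (2 * n - j + 3)%:R
             * 'C(2 * n - j + 3, n - l)%:R)
          * (r%:R - 1) ^+ (n - j) :> rat,
      U r 0 0 = r &
      forall n l : nat,
        (U r n l)%:R =
        riordan (Sr r ^+ 2 * (1 + fpsC (r%:R - 1) * Sr r))
                (fpsX * fpsC (r%:R - 1) * Sr r ^+ 2) n l].
Proof.
have closed n l : (l <= n)%N -> (U r n l)%:R =
        \sum_(0 <= j < (n - l).+1)
          'C(n - l, j)%:R *
          ((2 * l + 2)%:R / (2 * n - j + 2)%:R * 'C(2 * n - j + 2, n - l)%:R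
           + (2 * l + 3)%:R * (r%:R - 1) / (2 * n - j + 3)%:R
             * 'C(2 * n - j + 3, n - l)%:R)
          * (r%:R - 1) ^+ (n - j) :> rat.
  move=> le_ln; rewrite U_riordan /riordan.
  set S := Sr r; set C := fpsC _.
  have -> : S ^+ 2 * (1 + C * S) * (fpsX * C * S ^+ 2) ^+ l =
      fpsX ^+ l * (C ^+ l * (S ^+ (2 * l + 2) + C * S ^+ (2 * l + 3))).
    by rewrite !exprMn !exprD; ring.
  rewrite -{1}(subnKC le_ln) coef_fpsXnM coef_fpsCnM coef_fpsD coef_fpsCM.
  rewrite !coef_Sr_exp; [|lia..].
  rewrite !mulr_sumr -big_split mulr_sumr big_mkord /=.
  (* The expansion of S^k runs over the exponent i of r - 1, the claim over j = n - l - i; with the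
     factor (r - 1)^l the exponent becomes n - j. *)
  rewrite (reindex_inj rev_ord_inj); apply: eq_bigr => j _ /=.
  have le_j : (j <= n - l)%N by rewrite -ltnS.
  rewrite subSS /Sr_exp_term bin_sub //.
  have -> : (n - j = l + (n - l - j))%N by lia.
  have -> : (n - l + (n - l - j) + (2 * l + 2) = 2 * n - j + 2)%N by lia.
  have -> : (n - l + (n - l - j) + (2 * l + 3) = 2 * n - j + 3)%N by lia.
  by rewrite exprD; ring.
split=> //; last exact: U_riordan.
(* The only summand of the closed form is 2/2 + 3(r - 1)/3 = r. *)
apply/eqP; rewrite -(eqr_nat rat) closed // subn0 big_nat1 /=; apply/eqP.
by rewrite !bin0 !mulr1 !mul1r muln0 sub0n !add0n; field.
Qed.
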